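(* Let $n\ge1$ be an integer, $p\ge1$ and $q_0>0$. Then for every $q\in(q_0,\infty]$ there exists a positive function $u_0\in C^0(\mathbb{R}^n)\cap L^\infty(\mathbb{R}^n)$ such that $u_0\in L^{q_0}(\mathbb{R}^n)$ and such that for any $\delta>0$ one can find $C(\delta)>0$ with the property that the minimal solution $u$ of $u_t=u^p\Delta u$ in $\mathbb{R}^n\times(0,\infty)$, $u(\cdot,0)=u_0$, satisfies $$\|u(\cdot,t)\|_{L^q(\mathbb{R}^n)}\ge C(\delta)\,t^{-\left(1-\frac{q_0}{q}\right)/\left(p+\frac{2q_0}{n}\right)-\delta}\qquad\text{for all } t>1.$$
   Context: For $q=\infty$ the quotient $q_0/q$ is read as $0$. For $0<q<\infty$ (including $q<1$), $\|\varphi\|_{L^q(\mathbb{R}^n)}=\left(\int_{\mathbb{R}^n}|\varphi|^q\right)^{1/q}$ (possibly $+\infty$). For $T\in(0,\infty]$, a positive classical solution on $[0,T)$ of $u_t=u^p\Delta u$, $u(\cdot,0)=u_0$ is a positive function in $C^0(\mathbb{R}^n\times[0,T))\cap C^{2,1}(\mathbb{R}^n\times(0,T))$ satisfying the equation in $\mathbb{R}^n\times(0,T)$ and the initial condition. The minimal solution $u$ is the (unique) global positive classical solution ($T=\infty$) such that $u\le\tilde u$ in $\mathbb{R}^n\times(0,T)$ for every $T\in(0,\infty]$ and every positive classical solution $\tilde u$ on $[0,T)$; it exists for every positive $u_0\in C^0(\mathbb{R}^n)\cap L^\infty(\mathbb{R}^n)$ and satisfies $0<u\le\|u_0\|_{L^\infty(\mathbb{R}^n)}$.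 *)

(* Defs.v *)
From HB Require Import structures.
From mathcomp Require Import all_boot all_order all_algebra.
From mathcomp Require Import all_classical all_reals all_analysis.

Set Implicit Arguments.
Unset Strict Implicit.
Unset Printing Implicit Defensive.
Import Order.TTheory GRing.Theory Num.Theory.
Import numFieldNormedType.Exports.
Local Open Scope classical_set_scope.
Local Open Scope ring_scope.

(* Points of R^n are row vectors 'rV[R]_n (for calculus).  The product
   sigma-algebra is carried by n.-tuple R, so Lebesgue measure is built there, by
   iterated products, and L^q norms are transported along x |-> \row_i tnth x i. *)

Section cons_measure.
Local Open Scope ereal_scope.
Context (R : realType) (n : nat).
Local Notation Rm := (measurableTypeR R).
Variable mu : {sigma_finite_measure set (n.-tuple Rm) -> \bar R}.

Definition tuple_cons (z : Rm * n.-tuple Rm) : n.+1.-tuple Rm :=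
  [the n.+1.-tuple Rm of z.1 :: z.2].

Lemma measurable_tuple_cons : measurable_fun [set: _] tuple_cons.
Proof. by apply: measurable_cons. Qed.

Definition cons_measure : set (n.+1.-tuple Rm) -> \bar R :=
  pushforward (@lebesgue_measure R \x mu) tuple_cons.

Let preim A : measurable A -> measurable (tuple_cons @^-1` A).
Proof.
by move=> mA; rewrite -[X in measurable X]setTI; exact: measurable_tuple_cons.
Qed.

Let cons_measure0 : cons_measure set0 = 0.
Proof. by rewrite /cons_measure /pushforward preimage_set0 measure0. Qed.

Let cons_measure_ge0 A : 0 <= cons_measure A.
Proof. exact: (measure_ge0 (@lebesgue_measure R \x mu)). Qed.

Let cons_measure_sigma_additive : semi_sigma_additive cons_measure.
Proof.
move=> F mF tF mUF; rewrite /cons_measure /pushforward preimage_bigcup.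
apply: measure_semi_sigma_additive.
- by move=> k; exact: preim.
- apply/trivIsetP => /= i j _ _ ij; rewrite -preimage_setI.
  by move/trivIsetP : tF => /(_ _ _ _ _ ij) ->//; rewrite preimage_set0.
- by rewrite -preimage_bigcup; exact: preim.
Qed.

HB.instance Definition _ := isMeasure.Build _ _ _ cons_measure
  cons_measure0 cons_measure_ge0 cons_measure_sigma_additive.

Let cons_measure_sigma_finite : sigma_finite setT cons_measure.
Proof.
pose split (x : n.+1.-tuple Rm) : Rm * n.-tuple Rm :=
  (thead x, [tuple of behead x]).
have splitK x : split (tuple_cons x) = x.
  by case: x => a t; congr pair; apply: val_inj.
have msplit : measurable_fun setT split.
  apply/measurable_fun_pairP; split.
    exact: (measurable_tnth ord0).
  exact: measurable_behead.
have /sigma_finiteP[F [TF ndF Foo]] := sigma_finiteT (@lebesgue_measure R).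
have /sigma_finiteP[G [TG ndG Goo]] := sigma_finiteT mu.
exists (fun k => split @^-1` (F k `*` G k)).
  apply/esym; rewrite -subTset => x _.
  have : setT (split x).1 by [].
  have : setT (split x).2 by [].
  rewrite TF TG => -[j _ Gj] [i _ Fi]; exists (maxn i j) => //; split.
  - by move: Fi; apply/subsetPset/ndF/leq_maxl.
  - by move: Gj; apply/subsetPset/ndG/leq_maxr.
move=> k; have [mF Fk] := Foo k; have [mG Gk] := Goo k; split.
  rewrite -[X in measurable X]setTI; apply: msplit => //; exact: measurableX.
rewrite /cons_measure /pushforward (_ : _ @^-1` _ = F k `*` G k); last first.
  by rewrite -comp_preimage (_ : split \o tuple_cons = id)//; exact/funext.
by rewrite product_measure1E// lte_mul_pinfty// ge0_fin_numE.
Qed.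

HB.instance Definition _ := Measure_isSigmaFinite.Build _ _ _ cons_measure
  cons_measure_sigma_finite.

End cons_measure.

Fixpoint lebesgue_tuple (R : realType) (n : nat) :
    {sigma_finite_measure set (n.-tuple (measurableTypeR R)) -> \bar R} :=
  if n is m.+1 then cons_measure (lebesgue_tuple R m) else \d_([tuple]).

Lemma lebesgue_tuple_box (R : realType) (n : nat)
  (A : 'I_n -> set (measurableTypeR R)) : (forall i, measurable (A i)) ->
  lebesgue_tuple R n [set x | forall i, A i (tnth x i)] =
  (\prod_(i < n) lebesgue_measure (A i))%E.
Proof.
elim: n A => [|n IH] A mA.
  by rewrite big_ord0 /= diracE mem_set// => -[].
rewrite big_ord_recl -IH//= /cons_measure /pushforward.
rewrite -product_measure1E//; last first.
  rewrite (_ : [set _ | _] = \bigcap_(i in [set: 'I_n])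
      ((fun x => tnth x i) @^-1` A (lift ord0 i))); last first.
    by apply/seteqP; split=> x /= + i => /(_ i) //; exact.
  apply: fin_bigcap_measurable => // i _.
  by rewrite -[X in measurable X]setTI; exact: measurable_tnth.
congr ((_ \x _)%E _); apply/seteqP; split => -[a t] /=.
  move=> H; split; first exact: (H ord0).
  by move=> i; have := H (lift ord0 i); rewrite tnthS.
move=> [Aa At] i; case: (unliftP ord0 i) => [j ->|-> //].
by rewrite tnthS.
Qed.

(* q = +oo gives the essential supremum of |f| *)
Definition Lq_norm (R : realType) (n : nat) (q : \bar R) (f : 'rV[R]_n -> R) :
    \bar R :=
  Lnorm (lebesgue_tuple R n) q
    (fun x : n.-tuple (measurableTypeR R) => (f (\row_i tnth x i))%:E).

Definition partial (R : realType) (n : nat) (i : 'I_n) (f : 'rV[R]_n -> R) :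
    'rV[R]_n -> R :=
  'D_(delta_mx 0 i) f.

Definition laplacian (R : realType) (n : nat) (f : 'rV[R]_n -> R)
    (x : 'rV[R]_n) : R :=
  \sum_(i < n) partial i (partial i f) x.

Definition continuous_xt (R : realType) (n : nat) (D : set ('rV[R]_n * R))
    (v : 'rV[R]_n -> R -> R) : Prop :=
  {within D, continuous (fun z : 'rV[R]_n * R => v z.1 z.2)}.

(* R^n x [0, T) and R^n x (0, T), where T may be +oo *)
Definition cylinder0 (R : realType) (n : nat) (T : \bar R) :
  set ('rV[R]_n * R) := [set z | 0 <= z.2 /\ (z.2%:E < T)%E].
Definition cylinder (R : realType) (n : nat) (T : \bar R) :
  set ('rV[R]_n * R) := [set z | 0 < z.2 /\ (z.2%:E < T)%E].

(* 'D_v and derive1 are total, so existence of each derivative is required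
   separately from its continuity. *)
Definition C21 (R : realType) (n : nat) (T : \bar R)
    (u : 'rV[R]_n -> R -> R) : Prop :=
  [/\ continuous_xt (cylinder T) u,
      (forall x t, cylinder T (x, t) -> derivable (u x) t 1) /\
        continuous_xt (cylinder T) (fun x t => derive1 (u x) t),
      forall i : 'I_n,
        (forall x t, cylinder T (x, t) ->
           derivable (u^~ t) x (delta_mx 0 i)) /\
        continuous_xt (cylinder T) (fun x t => partial i (u^~ t) x) &
      forall i j : 'I_n,
        (forall x t, cylinder T (x, t) ->
           derivable (partial i (u^~ t)) x (delta_mx 0 j)) /\
        continuous_xt (cylinder T)
          (fun x t => partial j (partial i (u^~ t)) x)].

(* Values of u at times outside [0, T) are irrelevant. *)
Definition positive_classical_solution (R : realType) (n : nat) (p : R)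
    (u0 : 'rV[R]_n -> R) (T : \bar R) (u : 'rV[R]_n -> R -> R) : Prop :=
  [/\ forall x t, cylinder0 T (x, t) -> 0 < u x t,
      continuous_xt (cylinder0 T) u,
      C21 T u,
      forall x t, cylinder T (x, t) ->
        derive1 (u x) t = u x t `^ p * laplacian (u^~ t) x &
      forall x, u x 0 = u0 x].

Definition minimal_solution (R : realType) (n : nat) (p : R)
    (u0 : 'rV[R]_n -> R) (u : 'rV[R]_n -> R -> R) : Prop :=
  positive_classical_solution p u0 +oo%E u /\
  forall (T : \bar R) (v : 'rV[R]_n -> R -> R), (0 < T)%E ->
    positive_classical_solution p u0 T v ->
    forall x t, cylinder T (x, t) -> u x t <= v x t.

(* Main.v *)
(* On the cube of side r the datum u0 is at least a ~ r^(-n/q0-eps).  The shrinking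
   paraboloid a (1 - |x|^2/r^2) - nu s with nu = (2n+1) a^(p+1) / r^2 is a strict
   subsolution that is nonpositive outside the ball of radius r, where solutions are
   positive, so every positive classical solution lies above it.  It stays
   of height a/2 on a cube of side ~ r up to time ~ r^2 a^(-p).  Choosing r so that this time equals t, i.e. r ~ t^(1/(2+pn/q0+p eps)), the L^q norm
   at time t is at least of order a r^(n/q), which is the claimed power of t. *)
Require Import Defs.
From mathcomp Require Import all_boot all_order all_algebra.
From mathcomp Require Import all_classical all_reals all_analysis.
From mathcomp Require Import measurable_realfun ess_sup_inf.
From mathcomp Require Import ring lra.
Import Order.TTheory GRing.Theory Num.Theory.
Import numFieldNormedType.Exports.
Local Open Scope classical_set_scope.
Local Open Scope ring_scope.

Set Implicit Arguments.
Unset Strict Implicit.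
Unset Printing Implicit Defensive.

(** * Derivative tests at a minimum, along lines and in time *)

Lemma continuous_big (T : topologicalType) (R : realType) (I : Type) (s : seq I)
    (op : R -> R -> R) (idx : R) (f : I -> T -> R) :
  (forall g h : T -> R, continuous g -> continuous h ->
     continuous (fun x => op (g x) (h x))) ->
  (forall i, continuous (f i)) ->
  continuous (fun x => \big[op/idx]_(i <- s) f i x).
Proof.
move=> op_cont f_cont; elim: s => [|i s IH].
  by under eq_fun do rewrite big_nil; exact: cst_continuous.
by under eq_fun do rewrite big_cons; exact: op_cont.
Qed.

(** The derivative [f'] vanishes at the minimum. If [l] were negative, the difference quotients of
    [f'] would make [f'] negative just to the right of 0, and the mean value theorem would push [f]
    below [f 0]. *)
Lemma second_derive_ge0 (R : realType) (f f' : R -> R) (l : R) :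
  (forall x : R, is_derive x 1 f (f' x)) -> is_derive (0 : R) 1 f' l ->
  (forall x, f 0 <= f x) -> 0 <= l.
Proof.
move=> df df' fmin; rewrite leNgt; apply/negP => l0.
have f'0 : f' 0 = 0.
  have D0 : is_derive (0 : R) 1 f 0.
    apply: (@derive1_at_min _ f (-1) 1) .
    - by rewrite (le_trans (lerN10 _)).
    - move=> t _; exact: (@ex_derive _ _ _ _ _ _ _ (df t)).
    - by rewrite in_itv/= ltrN10 ltr01.
    - by move=> t _; exact: fmin.
  by have := @derive_val _ _ _ _ _ _ _ D0; rewrite (@derive_val _ _ _ _ _ _ _ (df 0)).
have /cvgr_lt/(_ 0 l0) : h^-1 *: ((f' \o shift 0) (h *: 1) - f' 0) @[h --> 0^'] --> l.
  rewrite -(@derive_val _ _ _ _ _ _ _ df').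
  exact: (@ex_derive _ _ _ _ _ _ _ df').
move=> /nbhs_ballP[e /= e0 He].
have f'lt0 h : 0 < h < e -> f' h < 0.
  move=> /andP[h0 he]; have := He h.
  rewrite /ball/= sub0r normrN gtr0_norm// => /(_ he); rewrite gt_eqF// => /(_ isT).
  by rewrite /= addr0 f'0 subr0 /GRing.scale/= mulr1 pmulr_rlt0 ?invr_gt0.
have [||c ce] := @MVT _ f f' 0 (e / 2) _ (fun x _ => df x).
- by rewrite divr_gt0.
- apply: derivable_within_continuous => x _.
  exact: (@ex_derive _ _ _ _ _ _ _ (df x)).
move=> fe; have := fmin (e / 2); rewrite -subr_ge0 fe.
move: ce; rewrite in_itv/= => /andP[c0 ce].
by rewrite leNgt subr0 pmulr_llt0 ?divr_gt0// f'lt0 ?c0//= (lt_trans ce)// gtr_pMr// invf_lt1// ltr1n.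
Qed.

Lemma is_derive_line (R : realType) (V : normedModType R) (F : V -> R)
    (x e : V) (h : R) : derivable F (h *: e + x) e ->
  is_derive h 1 (fun k => F (k *: e + x)) ('D_e F (h *: e + x)).
Proof.
have E : (fun k : R => k^-1 *: (((fun k => F (k *: e + x)) \o shift h) (k *: 1)
      - F (h *: e + x))) =
    (fun k : R => k^-1 *: ((F \o shift (h *: e + x)) (k *: e) - F (h *: e + x))).
  by apply/funext => k /=; rewrite [k *: 1]mulr1 scalerDl addrA.
by move=> dF; split; rewrite /derivable /derive E.
Qed.

(** The corrected restriction of [F] to the line has its minimum at [h = 0], where its second
    derivative is the one of [F] plus [2 * k]. The free linear term [b * h] absorbs the slope of the
    touching paraboloid. *)
Lemma derive2_ge_touching (R : realType) (V : normedModType R) (F : V -> R)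
    (x e : V) (b k : R) :
  (forall y, derivable F y e) -> derivable ('D_e F) x e ->
  (forall h, F x <= F (h *: e + x) + b * h + k * h ^+ 2) ->
  - (2 * k) <= 'D_e ('D_e F) x.
Proof.
move=> dF ddF Fmin.
rewrite -subr_ge0 opprK.
pose g h := F (h *: e + x) + b * h + k * h ^+ 2.
pose g' h := 'D_e F (h *: e + x) + b + k * (h *+ 2).
apply: (@second_derive_ge0 _ g g') => [h|| h].
- rewrite /g /g'.
  have := is_derive_line (dF (h *: e + x)) => d1.
  apply: is_derive_eq; rewrite /GRing.scale/=. ring.
- rewrite /g'.
  have : derivable ('D_e F) (0 *: e + x) e by rewrite scale0r add0r.
  move=> /is_derive_line; rewrite scale0r add0r => d1.
  apply: is_derive_eq; rewrite /GRing.scale/=. ring.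
- by rewrite /g scale0r add0r mulr0 expr0n/= mulr0 !addr0.
Qed.

(** Only earlier times are compared, because a minimum over a time interval may sit at its right
    end. A positive derivative would give a smaller value slightly before [t]. *)
Lemma derive1_le0_left_min (R : realType) (f : R -> R) (t : R) : 0 < t ->
  derivable f t 1 -> (forall s, 0 <= s <= t -> f t <= f s) -> f^`()%classic t <= 0.
Proof.
move=> t0 dft fmin; rewrite derive1E leNgt; apply/negP => l0.
have /cvgr_gt/(_ 0 l0) :
  h^-1 *: ((f \o shift t) (h *: 1) - f t) @[h --> 0^'] --> 'D_1 f t by exact: dft.
move=> /nbhs_ballP[e /= e0 He].
(* The step back stays inside the ball of the limit and does not pass time 0. *)
have m0 : 0 < Num.min (e / 2) t by rewrite lt_min divr_gt0.
set m := Num.min _ _ in m0.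
have me : m < e.
  by rewrite gt_min gtr_pMr// invf_lt1// ltr1n.
have := He (- m); rewrite /ball/= sub0r opprK gtr0_norm// => /(_ me).
rewrite lt_eqF ?oppr_lt0// => /(_ isT).
rewrite /GRing.scale/= mulr1 invrN mulNr oppr_gt0 pmulr_rlt0 ?invr_gt0//.
rewrite subr_lt0 ltNge fmin//.
by rewrite addrC subr_ge0 gerBl ge_min lexx orbT ltW.
Qed.

(** * Comparison of solutions with the shrinking paraboloid *)

Lemma continuous_sum_sqr (R : realType) (n : nat) :
  continuous (fun x : 'rV[R]_n => \sum_(i < n) x 0 i ^+ 2).
Proof.
apply: continuous_big => [g h cg ch x|i x]; first by exact: (cvgD (cg x) (ch x)).
apply: (@continuous_comp _ _ _ (fun x : 'rV[R]_n => x 0 i) (fun y => y ^+ 2)).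
  exact: coord_continuous.
exact: exprn_continuous.
Qed.

(** If the difference [w] of solution and paraboloid were negative somewhere, it would have a
    negative global minimum at a positive time. There the time derivative is at most [- nu], the
    Laplacian at least [- (2 * k * n)] and the solution at most [a]. The equation then contradicts
    [nu > 2 * n * k * a ^ p], which is why [nu] carries [2 * n + 1]. *)
Lemma paraboloid_le_solution (R : realType) (n : nat) (p : R)
    (u0 : 'rV[R]_n -> R) (u : 'rV[R]_n -> R -> R) (a r t : R) :
  0 <= p -> 0 < a -> 0 < r -> 0 <= t ->
  positive_classical_solution p u0 +oo%E u ->
  (forall x : 'rV[R]_n, (forall i, `|x 0 i| <= r) -> a <= u0 x) ->
  forall x : 'rV[R]_n, a - a / r ^+ 2 * (\sum_(i < n) x 0 i ^+ 2)
    - (2 * n%:R + 1) * (a / r ^+ 2) * a `^ p * t <= u x t.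
Proof.
move=> p0 a0 r0 t0 [upos uc [_ [dtu _] dxu dxxu] ueq uinit] u0a.
set k := a / r ^+ 2; set nu := _ * k * _.
have r20 : 0 < r ^+ 2 by rewrite exprn_gt0.
have k0 : 0 < k by rewrite divr_gt0.
have nu0 : 0 < nu.
  have n0 : 0 < 2 * n%:R + 1 :> R by rewrite ltr_wpDl// mulr_ge0// ler0n.
  by rewrite mulr_gt0 ?powR_gt0// mulr_gt0.
pose v (x : 'rV[R]_n) s := a - k * (\sum_(i < n) x 0 i ^+ 2) - nu * s.
have v_le (x : 'rV[R]_n) (s : R) : 0 <= s -> v x s <= a.
  move=> s0; rewrite /v -addrA gerDl -opprD oppr_le0 addr_ge0// mulr_ge0 ?(ltW k0) ?(ltW nu0)//.
  by apply: sumr_ge0 => i _; exact: sqr_ge0.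
have v_out (x : 'rV[R]_n) s i : 0 <= s -> r < `|x 0 i| -> v x s < 0.
  move=> s0 rx; rewrite /v -addrA -opprD subr_lt0.
  apply: ltr_wpDr; first by apply: mulr_ge0 => //; exact: ltW.
  (* As [a = k * r ^ 2], a single coordinate beyond [r] already makes the paraboloid negative. *)
  rewrite (_ : a = k * r ^+ 2) ?ltr_pM2l ?divfK ?lt0r_neq0// (bigD1 i)//= ltr_wpDr//.
    by apply: sumr_ge0 => j _; exact: sqr_ge0.
  by rewrite -[ltRHS]real_normK ?num_real// ltr_pXn2r// nnegrE ltW.
move=> x; rewrite -/(v x t) leNgt; apply/negP => uv.
(* A cube, to match the region where the datum is at least [a]; outside it positivity of [u] alone
   gives [w > 0]. *)
pose K := [set x : 'rV[R]_n | forall i, `[- r, r]%classic (x ord0 i)] `*` `[0, t]%classic.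
pose w (z : 'rV[R]_n * R) := u z.1 z.2 - v z.1 z.2.
have inK (y : 'rV[R]_n) s : 0 <= s <= t -> (forall i, `|y 0 i| <= r) -> K (y, s).
  by move=> st ry; split=> [i|] /=; rewrite in_itv//= -ler_norml.
have outK y s : 0 <= s <= t -> ~ K (y, s) -> 0 < w (y, s).
  move=> st; have /andP[s0 _] := st => nK; rewrite /w/= subr_gt0.
  have [i ri] : exists i, r < `|y 0 i|.
    apply: contrapT => /forallNP ry; apply: nK; apply: inK => // i.
    by rewrite leNgt; apply/negP.
  by apply: (lt_trans (v_out _ _ _ s0 ri)); apply: upos; split => //=; rewrite ltry.
have wx : w (x, t) < 0 by rewrite subr_lt0.
have Kx : K (x, t).
  apply: contrapT => /outK; rewrite t0 lexx => /(_ isT).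
  by rewrite ltNge ltW.
have cK : compact K.
  apply: compact_setX; last exact: segment_compact.
  by apply: (@rV_compact _ _ (fun=> `[- r, r]%classic)) => _; exact: segment_compact.
have uK : {within K, continuous (fun z : 'rV[R]_n * R => u z.1 z.2)}.
  apply: (continuous_subspaceW _ uc) => -[y s] [_] /=.
  by rewrite /cylinder0/= in_itv/= => /andP[-> _]; rewrite ltry.
have vK : {within K, continuous (fun z : 'rV[R]_n * R => v z.1 z.2)}.
  apply: continuous_subspaceT => z; rewrite /v.
  apply: cvgB; last by apply: cvgM; [exact: cvg_cst|exact: cvg_snd].
  apply: cvgB; first exact: cvg_cst.
  apply: cvgM; first exact: cvg_cst.
  apply: (@continuous_comp _ _ _ fst (fun x : 'rV[R]_n => \sum_(i < n) x 0 i ^+ 2)).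
    exact: cvg_fst.
  exact: continuous_sum_sqr.
have wc : {within K, continuous w} by move=> z; exact: (cvgB (uK z) (vK z)).
have [[x1 s1]] := compact_EVT_min (ex_intro _ _ Kx) cK wc.
rewrite inE => -[Kx1]; rewrite /= in_itv/= => st1 wmin.
have /andP[s10 s1t] := st1.
have w1 : w (x1, s1) < 0 by apply: le_lt_trans wx; apply: wmin; rewrite inE.
(* The minimum over [K] is negative, so it is also minimal over all of space, and the derivative
   tests apply even on the boundary of the cube. *)
have {}wmin (y : 'rV[R]_n) (s : R) : 0 <= s <= t -> w (x1, s1) <= w (y, s).
  move=> st; have [yK|yK] := pselect (K (y, s)); first by apply: wmin; rewrite inE.
  by rewrite (le_trans (ltW w1))// ltW// outK.
have s1gt0 : 0 < s1.
  rewrite lt_neqAle s10 andbT; apply/negP => /eqP s1E; move: w1.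
  rewrite -s1E /w/= uinit subr_lt0 ltNge => /negP; apply.
  rewrite (le_trans (v_le _ _ _))// u0a// => i.
  by have := Kx1 i; rewrite /= in_itv/= -ler_norml.
have cyl (y : 'rV[R]_n) : cylinder +oo (y, s1) by split=> //=; rewrite ltry.
have u1 : 0 < u x1 s1 by apply: upos; split=> //=; rewrite ltry.
(* This upper bound controls the degenerate coefficient [u ^ p] by [a ^ p]. *)
have u1a : u x1 s1 <= a.
  by apply: le_trans (v_le x1 s1 s10); move: w1; rewrite subr_lt0 => /ltW.
have ut : (u x1)^`()%classic s1 <= - nu.
  rewrite -subr_le0 opprK.
  have d1 : derivable (u x1) s1 1 by exact: dtu _ _ (cyl x1).
  have d2 : is_derive s1 (1 : R) (fun s => u x1 s + nu * s) ((u x1)^`()%classic s1 + nu).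
    have := DeriveDef d1 erefl => d3; apply: is_derive_eq.
    by rewrite derive1E /GRing.scale/= mulr1.
  have := @derive1_le0_left_min _ _ _ s1gt0 (@ex_derive _ _ _ _ _ _ _ d2).
  rewrite derive1E (@derive_val _ _ _ _ _ _ _ d2); apply => s /andP[s0 ss].
  have := wmin x1 s; rewrite s0 (le_trans ss s1t) /w/= /v => /(_ isT).
  lra.
have lapu : - (2 * k * n%:R) <= laplacian (u^~ s1) x1.
  have -> : - (2 * k * n%:R) = \sum_(i < n) - (2 * k).
    by rewrite sumr_const card_ord mulNrn mulr_natr.
  apply: ler_sum => i _.
  have [dxi _] := dxu i; have [dxxi _] := dxxu i i.
  (* The linear coefficient comes from expanding [k * (x1 0 i + h) ^ 2]. *)
  apply: (@derive2_ge_touching _ _ _ _ _ (2 * k * x1 0 i)) => [y||h].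
  - exact: dxi _ _ (cyl y).
  - exact: dxxi _ _ (cyl x1).
  have := wmin (h *: delta_mx 0 i + x1) s1 st1; rewrite /w/= /v.
  have -> : \sum_(j < n) (h *: delta_mx 0 i + x1) 0 j ^+ 2 =
      \sum_(j < n) x1 0 j ^+ 2 + (2 * x1 0 i * h + h ^+ 2).
    rewrite (bigD1 i)//= [in RHS](bigD1 i)//= !mxE !eqxx/= mulr1.
    rewrite (eq_bigr (fun j => x1 0 j ^+ 2)); last first.
      by move=> j ji; rewrite !mxE (negbTE ji) andbF mulr0 add0r.
    ring.
  lra.
have := ueq _ _ (cyl x1).
have up : u x1 s1 `^ p <= a `^ p by apply: ge0_ler_powR; rewrite ?nnegrE// ltW.
have up0 : 0 < u x1 s1 `^ p by rewrite powR_gt0.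
apply/eqP; rewrite lt_eqF//; apply: le_lt_trans ut _.
apply: (@lt_le_trans _ _ (u x1 s1 `^ p * - (2 * k * n%:R))); last first.
  by rewrite ler_pM2l.
(* The margin left by the extra 1 in [2 * n + 1] is [k * a ^ p > 0]. *)
rewrite mulrN ltrN2 /nu.
apply: (@le_lt_trans _ _ (a `^ p * (2 * k * n%:R))).
  by rewrite ler_wpM2r// mulr_ge0 ?ler0n// mulr_ge0// (ltW k0).
rewrite -subr_gt0 [ltRHS](_ : _ = k * a `^ p); last by ring.
by rewrite mulr_gt0 ?powR_gt0.
Qed.

(** * Lower bounds for norms, and integrals of products *)

(** Both integrals are suprema over nonnegative simple functions below the integrand, so
    monotonicity holds for arbitrary functions, measurable or not. *)
Lemma ge0_le_integralT (d : measure_display) (T : measurableType d) (R : realType)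
    (mu : {measure set T -> \bar R}) (f g : T -> \bar R) :
  (forall x, 0 <= f x)%E -> (forall x, f x <= g x)%E ->
  (\int[mu]_x f x <= \int[mu]_x g x)%E.
Proof.
move=> f0 fg; have g0 x : (0 <= g x)%E by rewrite (le_trans (f0 x)).
rewrite !ge0_integralTE//; apply: le_ereal_sup => _ [h /= hf <-].
by exists h => // x; rewrite (le_trans (hf x)).
Qed.

(** A Chebyshev bound, from comparing [f] with [h] times the indicator of [B]. The exponent
    [fine q^-1] treats finite and infinite [q] together. *)
Lemma Lnorm_ge_cst_on (d : measure_display) (T : measurableType d) (R : realType)
    (mu : {measure set T -> \bar R}) (q : \bar R) (f : T -> \bar R) (B : set T)
    (h m : R) :
  measurable B -> mu B = m%:E -> 0 < m -> (0 < q)%E -> 0 <= h ->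
  (forall x, B x -> (h%:E <= `|f x|)%E) ->
  ((h * m `^ fine q^-1)%:E <= Lnorm mu q f)%E.
Proof.
move=> mB muB m0 q0 h0 hf; rewrite unlock /Lnorm.
case: q q0 => [q| |//]; last first.
  (* For [q = +oo] the exponent is 0 and the claim is [h <= ess sup]: otherwise [B], of positive
     measure, would lie in a null set. *)
  move=> _; rewrite invey/= powRr0 mulr1 ifT; last first.
    apply: (@lt_le_trans _ _ (mu B)); first by rewrite muB lte_fin.
    by apply: le_measure; rewrite ?inE.
  rewrite leNgt; apply/negP => fh.
  have [N [mN muN0 BN]] := ess_sup_ge mu (abse \o f).
  have : (mu B <= mu N)%E.
    apply: le_measure; rewrite ?inE// => x Bx; apply: BN => /=.
    by apply/negP; rewrite -ltNge (lt_le_trans fh)// hf.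
  by rewrite muN0 muB lee_fin leNgt m0.
rewrite lte_fin => q0; rewrite inver gt_eqF//=.
have : ((h `^ q * m)%:E <= \int[mu]_x (`|f x| `^ q))%E.
  rewrite EFinM -muB -(setIT B) -(integral_indic mu measurableT)//.
  rewrite -ge0_integralZl//; last 2 first.
  - by apply/measurable_EFinP; exact: measurable_indic.
  - by rewrite lee_fin powR_ge0.
  apply: ge0_le_integralT => x; first by rewrite -EFinM lee_fin mulr_ge0// powR_ge0.
  rewrite indicE; have [xB|_] := boolP (x \in B); last by rewrite mule0 poweR_ge0.
  rewrite mule1 -poweR_EFin; apply: gt0_ler_poweR => //; first exact: ltW.
  - by rewrite in_itv/= leey lee_fin h0.
  - by rewrite in_itv/= leey abse_ge0.
  by apply: hf; rewrite inE in xB.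
move=> H; apply: le_trans (gt0_ler_poweR _ _ _ H).
- rewrite poweR_EFin lee_fin powRM ?powR_ge0//; last exact: ltW.
  by rewrite -powRrM mulfV ?gt_eqF// powRr1.
- by rewrite invr_ge0 ltW.
- by rewrite in_itv/= leey lee_fin mulr_ge0 ?powR_ge0// ltW.
- rewrite in_itv/= leey andbT; apply: integral_ge0 => x _; exact: poweR_ge0.
Qed.

Lemma Lq_norm_ge_cube (R : realType) (n : nat) (q : \bar R) (f : 'rV[R]_n -> R)
    (h l : R) :
  (0 < q)%E -> 0 <= h -> 0 < l ->
  (forall x : 'rV[R]_n, (forall i, `|x 0 i| <= l) -> h <= `|f x|) ->
  ((h * (2 * l) `^ (n%:R * fine q^-1))%:E <= Lq_norm q f)%E.
Proof.
move=> q0 h0 l0 hf; rewrite powRrM powR_mulrn; last by rewrite mulr_ge0// ltW.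
pose B := [set x : n.-tuple (measurableTypeR R) | forall i, `[- l, l]%classic (tnth x i)].
apply: (@Lnorm_ge_cst_on _ _ _ _ _ _ B) => //.
- rewrite (_ : B = \bigcap_(i in [set: 'I_n])
      ((fun x => tnth x i) @^-1` `[- l, l]%classic)); last first.
    by apply/seteqP; split=> x /= + i => /(_ i) //; exact.
  apply: fin_bigcap_measurable => // i _.
  rewrite -[X in measurable X]setTI; apply: measurable_tnth => //.
- apply: (eq_trans (@lebesgue_tuple_box R n (fun=> `[- l, l]%classic) _)).
    by move=> i; exact: measurable_itv.
  rewrite (eq_bigr (fun=> (2 * l)%:E)) => [|i _]; last first.
    rewrite lebesgue_measure_itv/= lte_fin ifT ?gtrN//.
    by rewrite -EFinB opprK mulr2n mulrDl mul1r.
  by rewrite prodEFin prodr_const card_ord.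
- by rewrite exprn_gt0// mulr_gt0.
- move=> x Bx; rewrite lee_fin; apply: hf => i; rewrite mxE ler_norml.
  by have := Bx i; rewrite /= in_itv.
Qed.

(** Induction on [n]: Tonelli splits off the head coordinate, and in dimension 0 the Dirac mass
    integrates the empty product to 1. *)
Lemma integral_lebesgue_tuple_prod (R : realType) (n : nat) (g : R -> R) :
  measurable_fun [set: measurableTypeR R] g -> (forall s, 0 <= g s) ->
  (\int[lebesgue_tuple R n]_x (\prod_(i < n) g (tnth x i))%:E =
   (\int[@lebesgue_measure R]_s (g s)%:E) ^+ n)%E.
Proof.
move=> mg g0.
have mprod m : measurable_fun [set: m.-tuple (measurableTypeR R)]
    (fun x => (\prod_(i < m) g (tnth x i))%:E).
  apply/measurable_EFinP; apply: measurable_prod => i _.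
  by apply: measurableT_comp => //; exact: measurable_tnth.
have prod0 m (x : m.-tuple R) : 0 <= \prod_(i < m) g (tnth x i).
  exact: prodr_ge0.
elim: n => [|n IH].
  by rewrite (integral_dirac _ _ (mprod 0)) // diracT mul1e big_ord0 expe0.
rewrite expeS -IH [LHS]/= /cons_measure ge0_integral_pushforward; last 4 first.
- exact: measurable_tuple_cons.
- exact: measurableT.
- exact: (mprod n.+1).
- by move=> x _; rewrite lee_fin; exact: prod0.
rewrite preimage_setT.
have -> : (fun x : n.+1.-tuple (measurableTypeR R) => (\prod_(i < n.+1) g (tnth x i))%:E)
     \o @tuple_cons R n =
   (fun z => ((g z.1)%:E * (\prod_(i < n) g (tnth z.2 i))%:E))%E.
  apply/funext => -[s x] /=; rewrite big_ord_recl EFinM; congr (_ * _%:E)%E.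
  by apply: eq_bigr => i _; rewrite tnthS.
rewrite fubini_tonelli1; last 2 first.
- apply: emeasurable_funM.
    by apply/measurable_EFinP; apply: measurableT_comp.
  exact: (measurableT_comp (mprod n)).
- by move=> z; rewrite -EFinM lee_fin mulr_ge0.
rewrite /fubini_F /=.
under eq_integral.
  move=> s _; rewrite ge0_integralZl ?lee_fin//; last by move=> x _; rewrite lee_fin; exact: prod0.
    over.
  exact: mprod.
rewrite ge0_integralZr//.
- exact/measurable_EFinP.
- by move=> s _; rewrite lee_fin.
- by apply: integral_ge0 => x _; rewrite lee_fin; exact: prod0.
Qed.

(* [log_tail] is integrable but decays more slowly than every [r^(-1-eps)], so
   one initial datum serves all [delta]. *)
Definition log_tail (R : realType) (s : R) : R :=
  ((expR 1 + `|s|) * ln (expR 1 + `|s|) ^+ 2)^-1.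

(** * The one-dimensional profile: bounds, integrability and decay *)

Section log_tail_theory.
Context {R : realType}.
Implicit Types s r : R.

Let e_gt0 s : 0 < expR 1 + `|s|.
Proof. by rewrite ltr_wpDr// expR_gt0. Qed.

(** The shift by [expR 1] serves this bound: it keeps the denominator of [log_tail] at least 1. *)
Let ln_ge1 s : 1 <= ln (expR 1 + `|s|).
Proof.
by rewrite -[leLHS](expRK 1) ler_ln ?posrE ?expR_gt0// lerDl.
Qed.

Let ln_gt0 s : 0 < ln (expR 1 + `|s|).
Proof. exact: lt_le_trans ltr01 (ln_ge1 s). Qed.

Let denom_gt0 s : 0 < (expR 1 + `|s|) * ln (expR 1 + `|s|) ^+ 2.
Proof. by rewrite mulr_gt0 ?exprn_gt0. Qed.

Let denom_ge1 s : 1 <= (expR 1 + `|s|) * ln (expR 1 + `|s|) ^+ 2.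
Proof.
apply: mulr_ege1; last by rewrite exprn_ege1// ln_ge1.
by rewrite ler_wpDr// (le_trans _ (expR_ge1Dx 1))// lerDl.
Qed.

Lemma log_tail_gt0 s : 0 < log_tail s.
Proof. by rewrite invr_gt0. Qed.

Lemma log_tail_le1 s : log_tail s <= 1.
Proof. by rewrite invf_le1. Qed.

Lemma log_tail_antitone s r : `|s| <= `|r| -> log_tail r <= log_tail s.
Proof.
move=> sr; rewrite lef_pV2 ?posrE//.
apply: ler_pM; rewrite ?sqr_ge0 ?lerD2l ?(ltW (e_gt0 _))//.
by rewrite ler_pXn2r ?nnegrE ?(ltW (ln_gt0 _))// ler_ln ?posrE// lerD2l.
Qed.

Lemma continuous_log_tail : continuous (@log_tail R).
Proof.
have ce s : {for s, continuous (fun s => expR 1 + `|s|)}.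
  by apply: cvgD; [exact: cvg_cst|exact: norm_continuous].
move=> s; apply: cvgV; first by rewrite gt_eqF.
apply: cvgM; first exact: ce.
apply: (@continuous_comp _ _ _ (fun s => ln (expR 1 + `|s|)) (fun y => y ^+ 2)).
  by apply: continuous_comp; [exact: ce|exact: continuous_ln].
exact: exprn_continuous.
Qed.

(** By evenness the half line suffices; there [- 1 / ln (e + s)] is an antiderivative that tends to
    0 at infinity. *)
Lemma log_tail_integral_lty : (\int[@lebesgue_measure R]_s (log_tail s)%:E < +oo)%E.
Proof.
rewrite ge0_symfun_integralT; last 3 first.
- by move=> s; rewrite ltW// log_tail_gt0.
- exact: continuous_log_tail.
- by move=> s; rewrite /log_tail /= normrN.
rewrite -set_itvcy.
pose F s : R := - (ln (expR 1 + s))^-1.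
have dF s : 0 <= s -> is_derive s 1 F (log_tail s).
  move=> s0; have es : 0 < expR 1 + s by have := e_gt0 s; rewrite ger0_norm.
  have lns : 1 <= ln (expR 1 + s) by have := ln_ge1 s; rewrite ger0_norm.
  have d1 : is_derive s 1 (fun s : R => expR 1 + s) 1.
    by apply: is_derive_eq; rewrite add0r mulr1.
  have d2 := @is_derive1_comp _ (@ln R) _ s _ _ (is_derive1_ln es) d1.
  have l0 : ln (expR 1 + s) != 0 by rewrite gt_eqF// (lt_le_trans _ lns).
  apply: is_derive_eq.
  rewrite /log_tail ger0_norm// /GRing.scale/= mulr1 !mulNr opprK invfM mulrC.
  by rewrite expr2 !invfM.
suff E : (\int[@lebesgue_measure R]_(x in `[0%R, +oo[) (log_tail x)%:E = 0%:E - (F 0)%:E)%E.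
  by rewrite [X in (_ * X)%E]E -EFinB -EFinM ltry.
apply: ge0_continuous_FTC2y.
- by move=> s _; rewrite ltW// log_tail_gt0.
- by apply: continuous_subspaceT; exact: continuous_log_tail.
- rewrite -[X in _ --> X]oppr0; apply: cvgN.
  apply/cvgrVy.
    near=> s; rewrite invr_gt0 (@lt_le_trans _ _ 1)//.
    have := ln_ge1 s; rewrite ger0_norm//.
  apply/cvgryPge => A; near=> s; rewrite /= invrK -[A]expRK ler_ln ?posrE ?expR_gt0//.
    by rewrite (@le_trans _ _ s)// lerDr expR_ge0.
  by rewrite ltr_wpDr ?expR_gt0.
- by move=> s s0; exact: (@ex_derive _ _ _ _ _ _ _ (dF s (ltW s0))).
- apply: cvg_at_right_filter; apply: differentiable_continuous.
  apply/derivable1_diffP; exact: (@ex_derive _ _ _ _ _ _ _ (dF 0 (lexx _))).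
- move=> s; rewrite in_itv/= andbT => s0.
  by rewrite derive1E (@derive_val _ _ _ _ _ _ _ (dF s (ltW s0))).
Unshelve. all: by end_near. Qed.

(** With [y = e + r], the bound [ln y <= y ^ b / b] makes the squared logarithm cost only
    [y ^ eps / b ^ 2], whence [b = eps / 2]; for [r >= 1] one has [y <= M * r], which turns powers
    of [y] into powers of [r]. *)
Lemma log_tail_lower_bound (eps : R) : 0 < eps ->
  exists2 c : R, 0 < c & forall r, 1 <= r -> c * r `^ (- (1 + eps)) <= log_tail r.
Proof.
move=> eps0; set b := eps / 2; have b0 : 0 < b by rewrite divr_gt0.
set M := expR 1 + 1 : R; have M0 : 0 < M by rewrite addr_gt0// expR_gt0.
exists (b ^+ 2 * M `^ (- (1 + eps))) => [|r r1].
  by rewrite mulr_gt0 ?exprn_gt0// powR_gt0.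
have r0 : 0 < r by rewrite (lt_le_trans _ r1).
rewrite -mulrA -powRM ?(ltW M0) ?(ltW r0)//.
set y := expR 1 + `|r|.
have y0 : 0 < y := e_gt0 r.
have yM : y <= M * r.
  by rewrite /y gtr0_norm// mulrDl mul1r lerD2r ler_peMr// expR_ge0.
have lny : ln y <= y `^ b / b.
  rewrite ler_pdivlMr// mulrC -ln_powR; apply/ltW/ln_sublinear; exact: powR_gt0.
have -> : log_tail r = (y * ln y ^+ 2)^-1 by [].
apply: (@le_trans _ _ (b ^+ 2 * y `^ (- (1 + eps)))).
  rewrite ler_pM2l ?exprn_gt0// !powRN lef_pV2 ?posrE ?powR_gt0 ?mulr_gt0//.
  by apply: ge0_ler_powR; rewrite ?nnegrE ?addr_ge0 ?mulr_ge0 ?(ltW M0) ?(ltW r0) ?(ltW y0) ?(ltW eps0).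
rewrite powRN -lef_pV2 ?posrE; last 2 first.
- by rewrite invr_gt0 denom_gt0.
- by rewrite divr_gt0 ?exprn_gt0 ?powR_gt0.
rewrite invrK invfM invrK.
rewrite powRD; last by rewrite gt_eqF ?implybT// addr_gt0.
rewrite powRr1; last exact: ltW.
rewrite [leRHS]mulrCA ler_pM2l//.
have -> : y `^ eps = (y `^ b) ^+ 2.
  by rewrite -powR_mulrn ?powR_ge0// -powRrM /b divfK.
rewrite -exprVn -exprMn ler_pXn2r ?nnegrE ?mulr_ge0 ?invr_ge0 ?powR_ge0 ?(ltW b0)//.
  by rewrite mulrC.
exact: ltW (ln_gt0 r).
Qed.

End log_tail_theory.

(** * Persistence of half the height, and the arithmetic of exponents *)

(** On the smaller cube the squared norm is at most [r ^ 2 / (4 * n)], so the quadratic term of the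
    paraboloid costs at most [a / 4]; the condition on [t] lets the time term cost at most another
    [a / 4]. *)
Lemma half_le_solution_on_cube (R : realType) (n : nat) (p : R)
    (u0 : 'rV[R]_n -> R) (u : 'rV[R]_n -> R -> R) (a r t : R) :
  (0 < n)%N -> 0 <= p -> 0 < a -> 0 < r -> 0 <= t ->
  positive_classical_solution p u0 +oo%E u ->
  (forall x : 'rV[R]_n, (forall i, `|x 0 i| <= r) -> a <= u0 x) ->
  4 * (2 * n%:R + 1) * a `^ p * t <= r ^+ 2 ->
  forall x : 'rV[R]_n, (forall i, `|x 0 i| <= r / (2 * n%:R)) -> a / 2 <= u x t.
Proof.
move=> n0 p0 a0 r0 t0 solu u0a tr x xr.
apply: le_trans (paraboloid_le_solution p0 a0 r0 t0 solu u0a x).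
have n1 : 1 <= n%:R :> R by rewrite ler1n.
have r20 : 0 < r ^+ 2 by rewrite exprn_gt0.
set S := \sum_(i < n) x 0 i ^+ 2; set k := a / r ^+ 2.
have aE : a = k * r ^+ 2 by rewrite divfK ?gt_eqF.
have k0 : 0 < k by rewrite divr_gt0.
have S_le : 4 * S <= r ^+ 2.
  have : S <= \sum_(i < n) (r / (2 * n%:R)) ^+ 2.
    apply: ler_sum => i _; rewrite -[leLHS]real_normK ?num_real//.
    by rewrite ler_pXn2r ?nnegrE ?divr_ge0// ?mulr_ge0 ?(ltW r0).
  rewrite sumr_const card_ord -[leRHS]mulr_natr => SS.
  apply: (@le_trans _ _ (r ^+ 2 / n%:R)); last first.
    by rewrite ler_pdivrMr ?(lt_le_trans _ n1)// ler_peMr// ltW.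
  rewrite (_ : r ^+ 2 / n%:R = 4 * ((r / (2 * n%:R)) ^+ 2 * n%:R)); first by rewrite ler_pM2l.
  by move: (n%:R : R) n1 => N N1; field; rewrite gt_eqF// (lt_le_trans _ N1).
have kS : k * (4 * S) <= k * r ^+ 2 by rewrite ler_pM2l.
have kt : k * (4 * (2 * n%:R + 1) * a `^ p * t) <= k * r ^+ 2 by rewrite ler_pM2l.
rewrite -aE in kS kt.
rewrite (_ : (2 * n%:R + 1) * k * a `^ p * t =
  k * (4 * (2 * n%:R + 1) * a `^ p * t) / 4); last by field.
rewrite (_ : k * S = k * (4 * S) / 4); last by field.
lra.
Qed.

(** For [delta = 0] both sides agree. In general [delta] enlarges the denominator, which weakens the
    decay from [b * th], and the extra [delta] is divided by a number at least 1. *)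
Lemma decay_exponent_le (R : realFieldType) (b th p delta : R) :
  0 < b -> 0 <= th -> 0 <= p -> 0 <= delta ->
  - th / (p + 2 / b) - delta <= (- (b * th) - delta) / (2 + p * (b + delta)).
Proof.
move=> b0 th0 p0 d0.
have D1 : 0 < 2 + p * b by rewrite ltr_wpDr// mulr_ge0// ltW.
have D12 : 2 + p * b <= 2 + p * (b + delta).
  by rewrite mulrDr addrA lerDl mulr_ge0.
have D2 := lt_le_trans D1 D12.
have bth : 0 <= b * th by rewrite mulr_ge0// ltW.
have -> : - th / (p + 2 / b) = - (b * th / (2 + p * b)).
  by field; rewrite !gt_eqF.
rewrite -!opprD mulNr lerN2 mulrDl lerD//.
  by rewrite ler_wpM2l// lef_pV2.
rewrite ler_pdivrMr// ler_peMr//.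
by rewrite (le_trans _ D12)// (@le_trans _ _ 2) ?ler1n// lerDl mulr_ge0// ltW.
Qed.

(** * The initial datum and its properties *)

Section initial_datum.
Context {R : realType} (n : nat) (q0 : R).
Hypothesis q00 : 0 < q0.

(** A product over coordinates rather than a radial function, so that its [q0]-th power integrates
    one variable at a time. *)
Definition slow_datum (x : 'rV[R]_n) : R :=
  (\prod_(i < n) log_tail (x 0 i)) `^ q0^-1.

Let prod_gt0 (x : 'I_n -> R) : 0 < \prod_(i < n) log_tail (x i).
Proof. by apply: prodr_gt0 => i _; exact: log_tail_gt0. Qed.

Lemma slow_datum_gt0 x : 0 < slow_datum x.
Proof. exact/powR_gt0/prod_gt0. Qed.

Lemma continuous_slow_datum : continuous slow_datum.
Proof.
move=> x; apply: (@continuous_comp _ _ _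
  (fun x : 'rV[R]_n => \prod_(i < n) log_tail (x 0 i)) (fun y => y `^ q0^-1)).
  apply: continuous_big => [g h cg ch y|i y]; first exact: (cvgM (cg y) (ch y)).
  apply: (@continuous_comp _ _ _ (fun x : 'rV[R]_n => x 0 i) (@log_tail R)).
    exact: coord_continuous.
  exact: continuous_log_tail.
apply: differentiable_continuous; apply/derivable1_diffP.
by apply: derivable_powR; rewrite in_itv/= andbT prod_gt0.
Qed.

Lemma slow_datum_Linfty : (Lq_norm +oo slow_datum < +oo)%E.
Proof.
rewrite /Lq_norm unlock /Lnorm; case: ifP => // _.
apply: (@le_lt_trans _ _ 1%E); last by rewrite ltry.
apply/ess_supP; apply: nearW => x /=.
rewrite lee_fin ger0_norm ?(ltW (slow_datum_gt0 _))// /slow_datum.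
rewrite [leRHS](_ : 1 = 1 `^ q0^-1); last by rewrite powR1.
apply: ge0_ler_powR.
- by rewrite invr_ge0 ltW.
- by rewrite nnegrE ltW// prod_gt0.
- by rewrite nnegrE.
- by apply: prodr_ile1 => i _; rewrite ltW ?log_tail_gt0// log_tail_le1.
Qed.

Lemma slow_datum_Lq0 : (Lq_norm q0%:E slow_datum < +oo)%E.
Proof.
rewrite /Lq_norm unlock /Lnorm; apply: poweR_lty.
apply: (@le_lt_trans _ _
    (\int[lebesgue_tuple R n]_x (\prod_(i < n) log_tail (tnth x i))%:E)%E).
  apply: ge0_le_integralT => x; first exact: poweR_ge0.
  rewrite /= ger0_norm ?(ltW (slow_datum_gt0 _))//.
  rewrite /slow_datum -powRrM mulVf ?gt_eqF// powRr1; last exact/ltW/prod_gt0.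
  rewrite lee_fin; apply: ler_prod => i _.
  by rewrite mxE lexx andbT ltW ?log_tail_gt0.
rewrite (@integral_lebesgue_tuple_prod _ _ (@log_tail R)).
- rewrite -ge0_fin_numE; last first.
    by rewrite expe_ge0// integral_ge0// => s _; rewrite lee_fin ltW// log_tail_gt0.
  apply: fin_numX; rewrite ge0_fin_numE ?log_tail_integral_lty//.
  by apply: integral_ge0 => s _; rewrite lee_fin ltW// log_tail_gt0.
- exact: continuous_measurable_fun continuous_log_tail.
- by move=> s; rewrite ltW// log_tail_gt0.
Qed.

(** On the cube each of the [n] factors is at least [log_tail r]; the power [1 / q0] of their
    product gives the exponent [n / q0]. Only [c] depends on [eps], not the datum. *)
Lemma slow_datum_lower_bound (eps : R) : 0 < eps ->
  exists2 c : R, 0 < c & forall (r : R) (x : 'rV[R]_n), 1 <= r ->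
    (forall i, `|x 0 i| <= r) -> c * r `^ (- (n%:R / q0 * (1 + eps))) <= slow_datum x.
Proof.
move=> eps0; have [c c0 cr] := log_tail_lower_bound eps0.
exists (c `^ (n%:R / q0)) => [|r x r1 xr]; first exact: powR_gt0.
have r0 : 0 < r := lt_le_trans ltr01 r1.
rewrite -mulrN [_ * - _]mulrC [r `^ _]powRrM -powRM ?(ltW c0) ?powR_ge0// powRrM.
have P0 : 0 <= c * r `^ (- (1 + eps)) by rewrite mulr_ge0 ?powR_ge0// ltW.
rewrite powR_mulrn//; apply: ge0_ler_powR.
- by rewrite invr_ge0 ltW.
- by rewrite nnegrE exprn_ge0.
- by rewrite nnegrE ltW// prod_gt0.
rewrite -[X in _ ^+ X](card_ord n) -prodr_const; apply: ler_prod => i _.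
rewrite P0/= (le_trans (cr r r1))// log_tail_antitone//.
by rewrite [leRHS]gtr0_norm.
Qed.

End initial_datum.

(* The extended-real quotient q0%:E / q is 0 for q = +oo. *)
Theorem theorem1p4 (R : realType) (n : nat) (p q0 : R) (q : \bar R) :
  (1 <= n)%N -> 1 <= p -> 0 < q0 -> (q0%:E < q)%E ->
  exists u0 : 'rV[R]_n -> R,
    [/\ forall x, 0 < u0 x,
        continuous u0,
        (Lq_norm +oo u0 < +oo)%E,
        (Lq_norm q0%:E u0 < +oo)%E &
        forall delta : R, 0 < delta ->
          exists2 C : R, 0 < C &
            forall u : 'rV[R]_n -> R -> R, minimal_solution p u0 u ->
              forall t : R, 1 < t ->
                ((C * t `^ (- (1 - fine (q0%:E / q)) / (p + 2 * q0 / n%:R)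
                            - delta))%:E
                 <= Lq_norm q (u^~ t))%E].
Proof.
move=> n1 p1 q00 q0q; exists (@slow_datum R n q0); split.
- exact: slow_datum_gt0.
- exact: continuous_slow_datum.
- exact: slow_datum_Linfty.
- exact: slow_datum_Lq0.
move=> delta d0.
have N0 : 0 < n%:R :> R by rewrite ltr0n.
have p0 : 0 <= p := le_trans ler01 p1.
have q_gt0 : (0 < q)%E by rewrite (lt_trans _ q0q)// lte_fin.
set s := fine q^-1.
(* Here [s] stands for [1 / q], equal to 0 when [q = +oo]. *)
have [sE s0 qs1] : [/\ fine (q0%:E / q) = q0 * s, 0 <= s & q0 * s <= 1].
  rewrite /s; case: (q) (q0q) (q_gt0) => [q'| |//]; last first.
    by move=> _ _; rewrite invey mule0 /= mulr0.
  rewrite !lte_fin => q0q' q'_gt0; rewrite inver gt_eqF//=; split => //.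
    by rewrite invr_ge0 ltW.
  by rewrite ler_pdivrMr// mul1r ltW.
rewrite sE; set b := n%:R / q0.
have b0 : 0 < b by rewrite divr_gt0.
have ns : n%:R * s = b * (q0 * s) by rewrite /b mulrA divfK ?gt_eqF.
(* The choice [eps = delta / b] turns the decay exponent [b * (1 + eps)] into [g = b + delta]. *)
have [c c0 cr] := @slow_datum_lower_bound R n q0 q00 _ (divr_gt0 d0 b0).
rewrite -/b mulrDr mulr1 mulrCA mulfV ?gt_eqF// mulr1 in cr.
set g := b + delta in cr.
have g0 : 0 < g by rewrite addr_gt0.
(* With height [a = c * r ^ (- g)], the time condition of [half_le_solution_on_cube] becomes
   [M * t <= r ^ m]. *)
set m := 2 + p * g.
have m1 : 1 <= m by rewrite ler_wpDr ?mulr_ge0 ?(ltW g0)// ler1n.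
have m0 : 0 < m := lt_le_trans ltr01 m1.
set M := 4 * (2 * n%:R + 1) * c `^ p.
have M0 : 0 <= M by rewrite !mulr_ge0 ?powR_ge0// addr_ge0// mulr_ge0.
(* For [r = K * t ^ (1 / m)], [K >= 1] gives [r >= 1], and [K ^ m >= K >= M] gives
   [M * t <= r ^ m]. *)
set K := 1 + M.
have K1 : 1 <= K by rewrite lerDl.
have K0 : 0 < K := lt_le_trans ltr01 K1.
(* These are the factors free of [t] in [a / 2 * (r / n) ^ (n * s)], where [r / n] is the side of
   the cube of half height. *)
exists (c / 2 * n%:R^-1 `^ (n%:R * s) * K `^ (n%:R * s - g)).
  by rewrite !mulr_gt0 ?powR_gt0 ?invr_gt0.
move=> u [solu _] t t1.
have t0 : 0 < t := lt_trans ltr01 t1.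
set r := K * t `^ m^-1.
have r1 : 1 <= r.
  rewrite mulr_ege1// -[leLHS](powRr0 t) ler_powR ?invr_ge0 ?(ltW t1)//.
  exact: ltW.
have r0 : 0 < r := lt_le_trans ltr01 r1.
have rm : M * t <= r `^ m.
  rewrite powRM ?powR_ge0 ?(ltW K0)// -powRrM mulVf ?gt_eqF// powRr1 ?(ltW t0)//.
  rewrite ler_pM2r// (@le_trans _ _ K) ?lerDr//.
  exact: le1r_powR.
set a := c * r `^ (- g).
have a0 : 0 < a by rewrite mulr_gt0 ?powR_gt0.
have small : 4 * (2 * n%:R + 1) * a `^ p * t <= r ^+ 2.
  rewrite powRM ?powR_ge0 ?(ltW c0)// -powRrM !mulrA -/M mulrAC.
  rewrite mulNr powRN ler_pdivrMr ?powR_gt0// -powR_mulrn ?(ltW r0)// -powRD.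
    by rewrite [g * p]mulrC.
  by rewrite (gt_eqF r0) implybT.
have half := half_le_solution_on_cube n1 p0 a0 r0 (ltW t0) solu
  (fun x => cr r x r1) small.
have l0 : 0 < r / (2 * n%:R) by rewrite divr_gt0// mulr_gt0.
have := @Lq_norm_ge_cube R n q (u^~ t) (a / 2) _ q_gt0 _ l0.
rewrite -/s => lower; apply: le_trans (lower _ _); first last.
- by move=> x /half ax; rewrite (le_trans ax)// ler_norm.
- by rewrite divr_ge0// ltW.
rewrite lee_fin.
have -> : 2 * (r / (2 * n%:R)) = n%:R^-1 * r by field; rewrite gt_eqF.
rewrite [(_ * r) `^ _]powRM ?invr_ge0 ?(ltW N0) ?(ltW r0)//.
have -> : a / 2 * (n%:R^-1 `^ (n%:R * s) * r `^ (n%:R * s)) =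
    c / 2 * n%:R^-1 `^ (n%:R * s) * r `^ (n%:R * s - g).
  by rewrite /a powRD ?(gt_eqF r0) ?implybT//; ring.
rewrite [r `^ _]powRM ?powR_ge0 ?(ltW K0)// -powRrM -mulrA.
rewrite !mulrA ler_wpM2l//.
  by rewrite !mulr_ge0 ?powR_ge0 ?invr_ge0 ?(ltW c0).
(* Since [t > 1], only the exponents remain to be compared. *)
apply: ler_powR; first exact: ltW.
rewrite [leRHS]mulrC /m /g ns.
have -> : b * (q0 * s) - (b + delta) = - (b * (1 - q0 * s)) - delta by ring.
have -> : 2 * q0 / n%:R = 2 / b by rewrite /b invfM invrK mulrA mulrAC.
by apply: decay_exponent_le => //; [rewrite subr_ge0|exact: ltW].
Qed.
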